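(* Let $\mathcal H$ be a separable infinite-dimensional Hilbert space and let $\{g_k\}_{k=1}^\infty$ be a sequence in $\mathcal H$. Then the following hold: (i) If $\{g_k\}_{k=1}^\infty$ is a Riesz sequence, there exists a Riesz basis $\{\psi_k\}_{k=1}^\infty$ for $\mathcal H$ such that $\|g_k-\psi_k\|\to 0$ as $k\to\infty$. (ii) If $\{g_k\}_{k=1}^\infty$ is a frame sequence, there exists a frame $\{\psi_k\}_{k=1}^\infty$ for $\mathcal H$ such that $\|g_k-\psi_k\|\to 0$ as $k\to\infty$. (iii) If $\{g_k\}_{k=1}^\infty$ is a Bessel sequence, there exists a complete Bessel sequence $\{\psi_k\}_{k=1}^\infty$ in $\mathcal H$ such that $\|g_k-\psi_k\|\to 0$ as $k\to\infty$. Moreover, in each of the cases (i)--(iii), given any $\delta>0$, the sequence $\{\psi_k\}_{k=1}^\infty$ can be chosen such that, in addition, $\|g_k-\psi_k\|\le\delta$ for all $k\in\mathbb N$.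
   Context: Hilbert spaces are over $\mathbb C$, and $\mathbb N=\{1,2,3,\dots\}$. A sequence $\{g_k\}_{k=1}^\infty$ in a Hilbert space $\mathcal K$ is a frame for $\mathcal K$ if there are constants $A,B>0$ with $A\|f\|^2\le\sum_{k=1}^\infty|\langle f,g_k\rangle|^2\le B\|f\|^2$ for all $f\in\mathcal K$; it is a Bessel sequence if at least the right-hand inequality holds for some $B>0$. A Riesz basis for $\mathcal K$ is a frame for $\mathcal K$ that is also a (Schauder) basis for $\mathcal K$; equivalently (for infinite-dimensional separable $\mathcal K$), it is the image of an orthonormal basis of $\mathcal K$ under a bounded bijective operator on $\mathcal K$. A sequence in $\mathcal H$ is a frame sequence (respectively, Riesz sequence) if it is a frame (respectively, Riesz basis) for the closed linear span of its elements. A sequence is complete in $\mathcal H$ if its closed linear span is $\mathcal H$. *)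

(* Defs.v *)
From HB Require Import structures.
From mathcomp Require Import all_boot all_order all_algebra.
From mathcomp Require Import all_classical all_reals all_analysis.
From mathcomp Require Export complex.

Set Implicit Arguments.
Unset Strict Implicit.
Unset Printing Implicit Defensive.

Import Order.TTheory GRing.Theory Num.Theory.
Import numFieldNormedType.Exports.

Local Open Scope classical_set_scope.
Local Open Scope ring_scope.

(* Over R[i] the library norm `|x| takes its values in R[i], where it is a
   nonnegative real; this is the same number in R. *)
Definition rnorm (R : realType) (V : normedZmodType R[i]) (x : V) : R :=
  complex.Re `|x|.

Definition separable (T : topologicalType) : Prop :=
  exists2 D : set T, countable D & dense D.

Definition infinite_dimensional (K : fieldType) (V : lmodType K) : Prop :=
  forall (n : nat) (v : 'I_n -> V),
    ~ (forall x : V, exists c : 'I_n -> K, x = \sum_(i < n) c i *: v i).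

(* All sequences are indexed by nat, so that g 0 stands for g_1.
   A Hilbert space is given by a complete normed module H over R[i] and an inner
   product [dot], linear in its first argument, with `|x| ^+ 2 = dot x x.
   In the definitions below E : set H is meant to be a closed subspace of H,
   regarded as a Hilbert space in its own right. *)
Section Frames.
Variables (R : realType) (H : completeNormedModType R[i]).
Variable dot : {dot H for Num.conj}.
Implicit Types (E : set H) (g : nat -> H).

Definition lin_span g : set H :=
  [set x | exists n (c : nat -> R[i]), x = \sum_(0 <= k < n) c k *: g k].

Definition closed_span g : set H := closure (lin_span g).

Definition complete_sequence g : Prop := closed_span g = setT.

(* The sum is taken in [0, +oo]. *)
Definition coef_energy g (f : H) : \bar R :=
  (\sum_(0 <= k <oo) (rnorm (dot f (g k) : R[i]) ^+ 2)%:E)%E.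

Definition bessel_for E g : Prop :=
  (forall k, E (g k)) /\
  exists2 B : R, 0 < B &
    forall f, E f -> (coef_energy g f <= (B * rnorm f ^+ 2)%:E)%E.

Definition frame_for E g : Prop :=
  (forall k, E (g k)) /\
  exists A B : R, [/\ 0 < A, 0 < B &
    forall f, E f ->
      ((A * rnorm f ^+ 2)%:E <= coef_energy g f)%E /\
      (coef_energy g f <= (B * rnorm f ^+ 2)%:E)%E].

Definition schauder_basis_for E g : Prop :=
  (forall k, E (g k)) /\
  forall f, E f ->
    exists! c : nat -> R[i], series (fun k => c k *: g k) n @[n --> \oo] --> f.

Definition riesz_basis_for E g : Prop :=
  frame_for E g /\ schauder_basis_for E g.

Definition bessel_sequence g : Prop := bessel_for setT g.

Definition frame_sequence g : Prop := frame_for (closed_span g) g.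

Definition riesz_sequence g : Prop := riesz_basis_for (closed_span g) g.

End Frames.

(* Main.v *)
(** Let E be the closed span of g and T the synthesis map, T e_k = g_k. Cut the
    index set into consecutive blocks of growing finite length L_j, let u_j be the
    unit vector of l^2 that is constant, equal to L_j^(-1/2), on the j-th block, and
    let f be an orthonormal basis of the orthogonal complement of E. Composing a
    bijection of {u_j} onto {u_j} u {f_i} with T on the span of the u_j, and keeping
    T on the orthogonal complement of that span, yields psi_k = U e_k, where U is
    (T + id) applied to the image of a unitary map from l^2 onto the direct sum of
    l^2 and the complement of E. Hence
      sum_k |<h, psi_k>|^2 = sum_k |<h, g_k>|^2 + |h - P_E h|^2,
    which gives the Bessel and frame bounds and the completeness of psi. As e_k has
    coefficient L_j^(-1/2) on u_j, also |psi_k - g_k| = O(L_j^(-1/2)) for k in the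
    j-th block. The same surgery applied to a sequence biorthogonal to g gives one
    biorthogonal to psi, so the Riesz case follows from the frame case. *)
Require Import Defs.
From HB Require Import structures.
From mathcomp Require Import all_boot all_order all_algebra.
From mathcomp Require Import all_classical all_reals all_analysis.
From mathcomp Require Import ring lra.
Set Implicit Arguments.
Unset Strict Implicit.
Unset Printing Implicit Defensive.
Import Order.TTheory GRing.Theory Num.Theory.
Import numFieldNormedType.Exports.
Local Open Scope classical_set_scope.
Local Open Scope ring_scope.
Local Open Scope complex_scope.

(** * Norms, convergence and inner products *)

Section RealNorm.
Variable R : realType.

Section NormedZmodule.
Variable V : normedZmodType R[i].
Implicit Types x y : V.

Lemma rnormE x : `|x| = (rnorm x)%:C.
Proof. by rewrite RRe_real// normr_real. Qed.

Lemma rnorm_ge0 x : 0 <= rnorm x.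
Proof. by rewrite -ler0c -rnormE. Qed.

Lemma rnorm0 : rnorm (0 : V) = 0.
Proof. by rewrite /rnorm normr0. Qed.

Lemma rnorm_eq0 x : (rnorm x == 0) = (x == 0).
Proof. by rewrite -[RHS]normr_eq0 rnormE eq_complex /= eqxx andbT. Qed.

Lemma rnormN x : rnorm (- x) = rnorm x.
Proof. by rewrite /rnorm normrN. Qed.

Lemma rdistC x y : rnorm (x - y) = rnorm (y - x).
Proof. by rewrite -rnormN opprB. Qed.

Lemma rnormD x y : rnorm (x + y) <= rnorm x + rnorm y.
Proof. by have := ler_normD x y; rewrite !rnormE -rmorphD lecR. Qed.

Lemma rnormB x y : rnorm (x - y) <= rnorm x + rnorm y.
Proof. by rewrite -(rnormN y) rnormD. Qed.

Lemma rnorm_sum n (F : nat -> V) m :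
  rnorm (\sum_(m <= k < n) F k) <= \sum_(m <= k < n) rnorm (F k).
Proof.
elim/big_rec2: _ => [|k a b _ le_ab]; first by rewrite rnorm0.
by rewrite (le_trans (rnormD _ _))// lerD2l.
Qed.

End NormedZmodule.

Lemma rnormZ (V : normedModType R[i]) (c : R[i]) (x : V) :
  rnorm (c *: x) = rnorm c * rnorm x.
Proof. by have := normrZ c x; rewrite !rnormE -rmorphM => /complexI. Qed.

Lemma rnormM (c d : R[i]) : rnorm (c * d) = rnorm c * rnorm d.
Proof. by have := normrM c d; rewrite !rnormE -rmorphM => /complexI. Qed.

Lemma rnormC (a : R) : rnorm a%:C = `|a|.
Proof. by rewrite /rnorm normc_def/= expr0n/= addr0 sqrtr_sqr. Qed.

Lemma rnorm_conj (c : R[i]) : rnorm c^*%C = rnorm c.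
Proof. by rewrite /rnorm normcJ. Qed.

Lemma sqr_rnorm (c : R[i]) : rnorm c ^+ 2 = complex.Re c ^+ 2 + complex.Im c ^+ 2.
Proof. by have := add_Re2_Im2 c; rewrite rnormE -rmorphXn => /complexI. Qed.

Lemma Re_le_rnorm (c : R[i]) : complex.Re c <= rnorm c.
Proof.
rewrite -lecR -rnormE; apply: le_trans (normc_ge_Re c).
by rewrite lecR ler_norm.
Qed.

End RealNorm.

Section Convergence.
Variables (R : realType) (H : completeNormedModType R[i]).
Implicit Types (u v : nat -> H) (x y : H).

(** Comparable elements of [R[i]] have equal imaginary parts, so a positive radius is real. This is
    what allows every epsilon in [R[i]] to be traded for one in [R]. *)
Lemma gt0_complexP (e : R[i]) : 0 < e -> exists2 r : R, 0 < r & e = r%:C.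
Proof.
case: e => a b; rewrite ltcE/= => /andP[/eqP -> a0]; exists a => //.
Qed.

Lemma cvg_rnormP u x :
  u n @[n --> \oo] --> x <->
  forall e : R, 0 < e -> \forall n \near \oo, rnorm (x - u n) < e.
Proof.
split => [/cvgrPdist_lt ux e e0|ux].
  have e0' : 0 < e%:C by rewrite (ltcR 0).
  by apply: filterS (ux _ e0') => n; rewrite rnormE ltcR.
apply/cvgrPdist_lt => _ /gt0_complexP[e e0 ->].
by apply: filterS (ux _ e0) => n; rewrite rnormE ltcR.
Qed.

Lemma cauchy_rnorm_cvg u :
  (forall e : R, 0 < e ->
     exists N, forall n m, (N <= n)%N -> (n <= m)%N -> rnorm (u m - u n) < e) ->
  exists x, u n @[n --> \oo] --> x.
Proof.
move=> cu; apply/cvg_ex/cauchy_cvgP/cauchy_exP => _ /gt0_complexP[e e0 ->].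
have [N hN] := cu e e0; exists (u N); exists N => // m /= Nm.
by rewrite -ball_normE/= rnormE ltcR rdistC hN.
Qed.

Lemma cvg_sqr_rnorm u x :
  u n @[n --> \oo] --> x -> rnorm (u n) ^+ 2 @[n --> \oo] --> rnorm x ^+ 2.
Proof.
move=> ux; rewrite expr2.
suff nx : rnorm (u n) @[n --> \oo] --> rnorm x.
  by under eq_fun do rewrite expr2; exact: cvgM.
apply/cvgrPdist_lt => e e0; move/cvg_rnormP: ux => /(_ e e0); apply: filterS => n.
apply: le_lt_trans; rewrite ler_norml; apply/andP; split.
  by rewrite lerNl opprB lerBlDr rdistC -{1}(subrK x (u n)) rnormD.
by rewrite lerBlDr -{1}(subrK (u n) x) rnormD.
Qed.

End Convergence.

Section InnerProduct.
Variables (R : realType) (H : completeNormedModType R[i]).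
Variable dot : {dot H for Num.conj}.
Hypothesis norm_dot : forall x : H, `|x| ^+ 2 = dot x x.
Implicit Types (x y z : H) (c : R[i]).

Lemma dotDl x y z : dot (x + y) z = dot x z + dot y z.
Proof. exact: linearDl. Qed.

Lemma dotBl x y z : dot (x - y) z = dot x z - dot y z.
Proof. exact: linearBl. Qed.

Lemma dotZl c x y : dot (c *: x) y = c * dot x y.
Proof. exact: linearZl_LR. Qed.

Lemma dot0l y : dot 0 y = 0.
Proof. exact: linear0l. Qed.

Lemma dotC x y : dot x y = (dot y x)^*%C.
Proof. by rewrite (hermC dot) expr0 mul1r. Qed.

Lemma dotDr x y z : dot x (y + z) = dot x y + dot x z.
Proof. exact: linearDr. Qed.

Lemma dotBr x y z : dot x (y - z) = dot x y - dot x z.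
Proof. exact: linearBr. Qed.

Lemma dot0r y : dot y 0 = 0.
Proof. exact: linear0r. Qed.

Lemma dotZr c x y : dot x (c *: y) = c^*%C * dot x y.
Proof. exact: linearZr_LR. Qed.

Lemma dot_suml m n (F : nat -> H) y :
  dot (\sum_(m <= k < n) F k) y = \sum_(m <= k < n) dot (F k) y.
Proof. exact: linear_sumlz. Qed.

Lemma dot_sumr m n (F : nat -> H) y :
  dot y (\sum_(m <= k < n) F k) = \sum_(m <= k < n) dot y (F k).
Proof. exact: linear_sumr. Qed.

Lemma dotxx x : dot x x = (rnorm x ^+ 2)%:C.
Proof. by rewrite -norm_dot rnormE rmorphXn. Qed.

Lemma dot_eq0C x y : dot x y = 0 -> dot y x = 0.
Proof. by move=> xy0; rewrite dotC xy0 conjc0. Qed.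

Lemma dotxx_eq0 x : dot x x = 0 -> x = 0.
Proof. by rewrite -norm_dot => /eqP; rewrite expf_eq0/= normr_eq0 => /eqP. Qed.

Lemma rnorm_dotC x y : rnorm (dot x y) = rnorm (dot y x).
Proof. by rewrite dotC rnorm_conj. Qed.

Lemma sqr_rnormD x y :
  rnorm (x + y) ^+ 2 = rnorm x ^+ 2 + rnorm y ^+ 2 + complex.Re (dot x y) *+ 2.
Proof.
have E z : rnorm z ^+ 2 = complex.Re (dot z z) by rewrite dotxx.
rewrite !E dotDl !dotDr (dotC y x).
by case: (dot x x) (dot x y) (dot y y) => a b [c d] [e f] /=; ring.
Qed.

Lemma sqr_rnormD_orth x y :
  dot x y = 0 -> rnorm (x + y) ^+ 2 = rnorm x ^+ 2 + rnorm y ^+ 2.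
Proof. by move=> xy0; rewrite sqr_rnormD xy0 mul0rn addr0. Qed.

Lemma cauchy_schwarz x y : rnorm (dot x y) <= rnorm x * rnorm y.
Proof.
have [->|y0] := eqVneq y 0.
  by rewrite dot0r rnorm0 mulr_ge0 ?rnorm_ge0.
have y20 : 0 < rnorm y ^+ 2.
  by rewrite exprn_gt0// lt_neqAle eq_sym rnorm_eq0 y0 rnorm_ge0.
(* [t *: y] is the orthogonal projection of [x] on the line of [y]; by Pythagoras it is no longer
   than [x]. *)
pose t := dot x y / (rnorm y ^+ 2)%:C.
have ty : dot (x - t *: y) (t *: y) = 0.
  rewrite dotZr dotBl dotZl dotxx /t mulfVK ?subrr ?mulr0//.
  by rewrite eq_complex/= eqxx andbT gt_eqF.
have := sqr_rnormD_orth ty; rewrite subrK rnormZ exprMn => xE.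
have tE : rnorm t * rnorm y ^+ 2 = rnorm (dot x y).
  by rewrite /t rnormM -rmorphV ?unitfE ?gt_eqF//= rnormC ger0_norm ?mulfVK ?gt_eqF//
     invr_ge0 ltW.
rewrite -ler_sqr ?nnegrE ?mulr_ge0 ?rnorm_ge0// exprMn -tE exprMn expr2 mulrA.
by rewrite ler_wpM2r ?(ltW y20)// xE -expr2 lerDr sqr_ge0.
Qed.

Lemma cvg_dotl (u : nat -> H) x y :
  u n @[n --> \oo] --> x ->
  forall e : R, 0 < e -> \forall n \near \oo, rnorm (dot x y - dot (u n) y) < e.
Proof.
move=> /cvg_rnormP ux e e0.
(* The added 1 keeps the divisor positive when [y] is zero. *)
have y1 : 0 < rnorm y + 1 by rewrite ltr_wpDl ?rnorm_ge0.
have := ux (e / (rnorm y + 1)); rewrite divr_gt0// => /(_ isT); apply: filterS => n.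
rewrite ltr_pdivlMr// => xn; rewrite -dotBl (le_lt_trans (cauchy_schwarz _ _))//.
by apply: le_lt_trans xn; rewrite ler_wpM2l ?rnorm_ge0// lerDl.
Qed.

(** Eventually constant inner products suffice: the inner product of a partial sum with one member
    of an orthonormal or biorthogonal family stabilises. *)
Lemma dot_lim (u : nat -> H) x y c :
  u n @[n --> \oo] --> x -> (\forall n \near \oo, dot (u n) y = c) -> dot x y = c.
Proof.
move=> ux uc; apply/eqP; rewrite -subr_eq0 -rnorm_eq0 eq_le rnorm_ge0 andbT.
apply/ler_addgt0Pl => e e0; rewrite addr0.
near \oo => n; have <- : dot (u n) y = c by near: n.
by apply: ltW; near: n; exact: cvg_dotl.
Unshelve. all: end_near. Qed.

End InnerProduct.

(** The partial sums increase to a limit that they never exceed, so beyond [N] a block is at most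
    the distance from its first partial sum to the limit. *)
Lemma bounded_series_tail (R : realType) (a : nat -> R) (C : R) :
  (forall k, 0 <= a k) -> (forall n, \sum_(0 <= k < n) a k <= C) ->
  forall e, 0 < e -> exists N, forall n m, (N <= n)%N -> (n <= m)%N ->
    \sum_(n <= k < m) a k < e.
Proof.
move=> a0 aC e e0.
have nd : {homo (fun n => \sum_(0 <= k < n) a k) : n m / (n <= m)%N >-> n <= m}.
  move=> n m nm; rewrite (big_cat_nat (leq0n n) nm)//=.
  by rewrite lerDl sumr_ge0.
have cs : cvgn (fun n => \sum_(0 <= k < n) a k).
  by apply: nondecreasing_is_cvgn => //; exists C => _ [n _ <-].
have /cvgrPdist_lt/(_ _ e0)[N _ hN] := cs.
exists N => n m Nn nm; have := hN _ Nn => /=.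
have lm : \sum_(0 <= k < m) a k <= limn (fun n => \sum_(0 <= k < n) a k).
  exact: nondecreasing_cvgn_le.
move: lm; rewrite (big_cat_nat (leq0n n) nm)//=; set l := limn _ => lm.
by move=> /(le_lt_trans (ler_norm _)); lra.
Qed.

(** * Bessel sequences and orthonormal systems *)

Section Bessel.
Variables (R : realType) (H : completeNormedModType R[i]).
Variable dot : {dot H for Num.conj}.
Hypothesis norm_dot : forall x : H, `|x| ^+ 2 = dot x x.
Implicit Types (x y z h : H) (c : nat -> R[i]) (g f d : nat -> H) (B : R).

(** Finite sums in [R] replace the energy in [[0, +oo]], and [h] ranges over the whole space rather
    than over a subspace; [bessel_boundP] and [frame_sequence_bessel] lead here from the stated
    definitions. *)
Definition bessel_bound g B :=
  forall h n, \sum_(0 <= k < n) rnorm (dot h (g k)) ^+ 2 <= B * rnorm h ^+ 2.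

(** The synthesis map is adjoint to the analysis map and inherits its bound. Stating this for a
    block [m <= k < n] makes it a Cauchy estimate for series. *)
Lemma bessel_synthesis g B c m n : 0 < B -> bessel_bound g B ->
  rnorm (\sum_(m <= k < n) c k *: g k) ^+ 2 <= B * \sum_(m <= k < n) rnorm (c k) ^+ 2.
Proof.
move=> B0 gB; set F := \sum_(m <= k < n) _.
have [nm|mn] := leqP n m.
  by rewrite /F !big_geq// rnorm0 expr0n/= mulr0.
have FE : rnorm F ^+ 2 = \sum_(m <= k < n) complex.Re (c k * dot (g k) F).
  have -> : rnorm F ^+ 2 = complex.Re (dot F F) by rewrite (dotxx norm_dot).
  rewrite {1}/F dot_suml -(raddf_sum (@complex.Re R : Rcomplex R -> R)).
  by congr complex.Re; apply: eq_bigr => k _; rewrite dotZl.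
(* [u v <= B u^2 / 2 + v^2 / (2 B)], with the Bessel bound applied to [F] itself *)
have le1 : rnorm F ^+ 2 <=
    \sum_(m <= k < n) (B / 2 * rnorm (c k) ^+ 2 + (2 * B)^-1 * rnorm (dot F (g k)) ^+ 2).
  rewrite FE; apply: ler_sum => k _.
  rewrite (le_trans (Re_le_rnorm _))// rnormM (rnorm_dotC _ F).
  set u := rnorm (c k); set v := rnorm _.
  rewrite -subr_ge0 [leRHS](_ : _ = (2 * B)^-1 * (B * u - v) ^+ 2).
    by rewrite mulr_ge0 ?sqr_ge0// invr_ge0; lra.
  by field; lra.
have le2 : \sum_(m <= k < n) rnorm (dot F (g k)) ^+ 2 <= B * rnorm F ^+ 2.
  apply: le_trans (gB F n); rewrite [leRHS](big_cat_nat (leq0n m) (ltnW mn))//=.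
  by rewrite lerDr sumr_ge0// => k _; rewrite sqr_ge0.
move: le1; rewrite big_split/= -!mulr_sumr => le1.
(* The second half of [le1] is thereby at most [rnorm F ^+ 2 / 2] and is absorbed on the left. *)
have := ler_wpM2l (ltW (_ : 0 < (2 * B)^-1)) le2.
rewrite invr_gt0 mulr_gt0// => /(_ isT); rewrite [leRHS](_ : _ = rnorm F ^+ 2 / 2); first by lra.
by field; lra.
Qed.

Lemma bessel_series_cvg g B c C : 0 < B -> bessel_bound g B ->
  (forall n, \sum_(0 <= k < n) rnorm (c k) ^+ 2 <= C) ->
  exists x, series (fun k => c k *: g k) n @[n --> \oo] --> x.
Proof.
move=> B0 gB cC; apply: cauchy_rnorm_cvg => e e0.
have [|N hN] := bounded_series_tail (fun k => sqr_ge0 (rnorm (c k))) cC (e := e ^+ 2 / B).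
  by rewrite divr_gt0// exprn_gt0.
exists N => n m Nn nm; rewrite sub_series_geq//.
rewrite -ltr_sqr ?nnegrE ?rnorm_ge0 ?(ltW e0)//.
rewrite (le_lt_trans (bessel_synthesis c n m B0 gB))//.
by rewrite mulrC -ltr_pdivlMr// hN.
Qed.

(* Zero vectors are allowed because Gram-Schmidt is applied to sequences that need not
   be linearly independent. *)
Definition orthonormal_or_zero f :=
  (forall i j, i != j -> dot (f i) (f j) = 0) /\
  (forall i, f i = 0 \/ dot (f i) (f i) = 1).

Lemma dot_fourier_sum f x n j : orthonormal_or_zero f ->
  dot (\sum_(0 <= k < n) dot x (f k) *: f k) (f j) =
    if (j < n)%N then dot x (f j) else 0.
Proof.
move=> [fo fn]; rewrite dot_suml.
have [jn|nj] := ltnP j n.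
  rewrite (big_cat_nat (leq0n j) (ltnW jn))//= [X in _ + X]big_ltn// !big1_seq ?addr0 ?add0r.
  - rewrite dotZl; have [->|->] := fn j; first by rewrite !dot0r mul0r.
    by rewrite mulr1.
  - move=> k; rewrite mem_index_iota => /andP[_ /andP[jk _]].
    by rewrite dotZl fo ?mulr0// gtn_eqF.
  - move=> k; rewrite mem_index_iota => /andP[_ /andP[_ kj]].
    by rewrite dotZl fo ?mulr0// ltn_eqF.
rewrite big_nat_cond big1// => k /andP[/andP[_ kn] _].
by rewrite dotZl fo ?mulr0// ltn_eqF// (leq_trans kn).
Qed.

Lemma fourier_sum_sqr f x n : orthonormal_or_zero f ->
  rnorm (\sum_(0 <= k < n) dot x (f k) *: f k) ^+ 2 =
  \sum_(0 <= k < n) rnorm (dot x (f k)) ^+ 2.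
Proof.
move=> fo; apply: complexI; rewrite -(dotxx norm_dot).
set F := \sum_(_ <= _ < _) _; rewrite {2}/F dot_sumr raddf_sum/=.
apply: eq_big_nat => k /andP[_ kn].
rewrite dotZr /F dot_fourier_sum// kn mulrC -sqr_normc rnormE.
by rewrite -rmorphXn.
Qed.

(** Bessel's inequality: the partial Fourier sum [F] is orthogonal to [h - F], so Pythagoras
    applies. *)
Lemma orthonormal_bessel f : orthonormal_or_zero f -> bessel_bound f 1.
Proof.
move=> fo h n; rewrite mul1r -(fourier_sum_sqr h n fo).
set F := \sum_(_ <= _ < _) _.
have oF : dot (h - F) F = 0.
  rewrite {2}/F dot_sumr big_nat_cond big1// => k /andP[/andP[_ kn] _].
  by rewrite dotZr dotBl dot_fourier_sum// kn subrr mulr0.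
by rewrite -[in leRHS](subrK F h) (sqr_rnormD_orth norm_dot oF) lerDr sqr_ge0.
Qed.

(** The limit [p] is the orthogonal projection of [x] on the closed span of [f]: the coefficient of
    a partial sum at [f j] is constant once the sum has passed [j]. The last clause is Parseval's
    identity. *)
Lemma fourier_projection f x : orthonormal_or_zero f ->
  exists p, [/\ series (fun k => dot x (f k) *: f k) n @[n --> \oo] --> p,
    forall j, dot (x - p) (f j) = 0 &
    \sum_(0 <= k < n) rnorm (dot x (f k)) ^+ 2 @[n --> \oo] --> rnorm p ^+ 2].
Proof.
move=> fo; have fb := orthonormal_bessel fo.
have [p sp] := bessel_series_cvg ltr01 fb (fb x).
exists p; split => //.
- move=> j; rewrite dotBl; apply/eqP; rewrite subr_eq0 eq_sym; apply/eqP.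
  apply: (dot_lim norm_dot sp); exists j.+1 => // n /= jn.
  by rewrite /series/= dot_fourier_sum// jn.
- have -> : (fun n => \sum_(0 <= k < n) rnorm (dot x (f k)) ^+ 2) =
    (fun n => rnorm (series (fun k => dot x (f k) *: f k) n) ^+ 2).
    by apply/funext => n; rewrite /series/= fourier_sum_sqr.
  exact: cvg_sqr_rnorm.
Qed.

End Bessel.

(** * Gram-Schmidt and orthogonal projections *)

Section Subspaces.
Variables (R : realType) (H : completeNormedModType R[i]).
Variable dot : {dot H for Num.conj}.
Hypothesis norm_dot : forall x : H, `|x| ^+ 2 = dot x x.
Implicit Types (x y z h : H) (c : R[i]) (g f d : nat -> H) (E : set H).

Definition subspace E := E 0 /\ forall c x y, E x -> E y -> E (c *: x + y).

Lemma subspace_sum E (c : nat -> R[i]) (u : nat -> H) m n : subspace E ->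
  (forall k, (m <= k < n)%N -> E (u k)) -> E (\sum_(m <= k < n) c k *: u k).
Proof.
move=> [E0 ED] Eu; rewrite big_nat_cond; elim/big_rec: _ => // k x /andP[kmn _] Ex.
by apply: ED => //; exact: Eu.
Qed.

Lemma subspaceB E x y : subspace E -> E x -> E y -> E (x - y).
Proof. by move=> [_ ED] Ex Ey; rewrite addrC -scaleN1r; apply: ED. Qed.

Lemma subspaceZ E c x : subspace E -> E x -> E (c *: x).
Proof. by move=> [E0 ED] Ex; rewrite -[_ *: _]addr0; apply: ED. Qed.

Lemma closure_rnormP E x :
  closure E x <-> forall e : R, 0 < e -> exists2 y, E y & rnorm (x - y) < e.
Proof.
split=> [Ex e e0|Ex B /nbhs_ballP[_ /gt0_complexP[e e0 ->]] xB].
  have [|y [Ey]] := Ex (ball x e%:C).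
    by apply: nbhsx_ballx; rewrite ltcR.
  by rewrite -ball_normE/= rnormE ltcR; exists y.
have [y Ey xy] := Ex _ e0; exists y; split => //; apply: xB.
by rewrite -ball_normE/= rnormE ltcR.
Qed.

Lemma closure_subspace E : subspace E -> subspace (closure E).
Proof.
move=> [E0 ED]; split; first exact: subset_closure.
move=> c x y /closure_rnormP Ex /closure_rnormP Ey; apply/closure_rnormP => e e0.
have c1 : 0 < rnorm c + 1 by rewrite ltr_wpDl ?rnorm_ge0.
have e2 : 0 < e / 2 by rewrite divr_gt0.
have [x' Ex' xx'] := Ex _ (divr_gt0 e2 c1).
have [y' Ey' yy'] := Ey _ e2.
exists (c *: x' + y'); first exact: ED.
rewrite opprD addrACA -scalerBr (le_lt_trans (rnormD _ _))// rnormZ.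
have : rnorm c * rnorm (x - x') <= e / 2.
  move: xx'; rewrite ltr_pdivlMr// => /ltW; apply: le_trans.
  by rewrite mulrC ler_wpM2l ?rnorm_ge0// lerDl.
by lra.
Qed.

Lemma closure_subspace_lim E (u : nat -> H) x :
  (forall n, E (u n)) -> u n @[n --> \oo] --> x -> closure E x.
Proof.
move=> Eu /cvg_rnormP ux; apply/closure_rnormP => e /ux[N _ /(_ N (leqnn N)) xN].
by exists (u N).
Qed.

Lemma subspace_lin_span g : subspace (lin_span g).
Proof.
split; first by exists 0, (fun=> 0); rewrite big_geq.
move=> c _ _ [n [a ->]] [m [b ->]].
(* Extension by zero brings two combinations of different lengths to a common length. *)
pose pad (a : nat -> R[i]) n k := if (k < n)%N then a k else 0.
have padE (a' : nat -> R[i]) p q : (p <= q)%N ->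
    \sum_(0 <= k < p) a' k *: g k = \sum_(0 <= k < q) pad a' p k *: g k.
  move=> pq; rewrite [RHS](big_cat_nat (leq0n p) pq)/= [X in _ + X]big1_seq.
    by rewrite addr0; apply: eq_big_nat => k /andP[_ kp]; rewrite /pad kp.
  move=> k; rewrite mem_index_iota => /andP[_ /andP[pk _]].
  by rewrite /pad ltnNge pk scale0r.
exists (maxn n m), (fun k => c * pad a n k + pad b m k).
rewrite (padE a _ _ (leq_maxl n m)) (padE b _ _ (leq_maxr n m)) scaler_sumr -big_split/=.
by apply: eq_bigr => k _; rewrite scalerDl scalerA.
Qed.

Lemma lin_span_mem g k : lin_span g (g k).
Proof.
exists k.+1, (fun j => (j == k)%:R); rewrite big_nat_recr//= eqxx scale1r big1_seq ?add0r//.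
move=> j; rewrite mem_index_iota => /andP[_ /andP[_ jk]].
by rewrite ltn_eqF// scale0r.
Qed.

Lemma subspace_closed_span g : subspace (closed_span g).
Proof. exact/closure_subspace/subspace_lin_span. Qed.

Lemma closed_span_orth g x y :
  (forall k, dot (g k) y = 0) -> closed_span g x -> dot x y = 0.
Proof.
move=> gy /closure_rnormP gx; apply/eqP; rewrite -rnorm_eq0 eq_le rnorm_ge0 andbT.
apply/ler_addgt0Pl => e e0; rewrite addr0.
have y1 : 0 < rnorm y + 1 by rewrite ltr_wpDl ?rnorm_ge0.
have [_ [n [c ->]]] := gx _ (divr_gt0 e0 y1).
set s := \sum_(_ <= _ < _) _; rewrite ltr_pdivlMr// => /ltW xs.
have sy : dot s y = 0.
  by rewrite dot_suml big1// => k _; rewrite dotZl gy mulr0.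
rewrite -[dot x y]subr0 -sy -dotBl (le_trans (cauchy_schwarz norm_dot _ _))//.
by apply: le_trans xs; rewrite ler_wpM2l ?rnorm_ge0// lerDl.
Qed.

Lemma subspace_orthl y : subspace [set x | dot y x = 0].
Proof.
by split=> [|c x z]/=; rewrite ?dot0r// dotDr dotZr => -> ->; rewrite mulr0 addr0.
Qed.

(** The list of all earlier vectors is carried along because each step subtracts the components on
    all of them. If [d m] depends on its predecessors then [r] is zero, and so is the vector
    appended. *)
Fixpoint gram_schmidt_seq d n : seq H :=
  if n is m.+1 then
    let s := gram_schmidt_seq d m in
    let r := d m - \sum_(v <- s) dot (d m) v *: v in
    rcons s ((rnorm r)^-1%:C *: r)
  else [::].

Lemma gram_schmidt_rec d : exists f, forall n,
  let r := d n - \sum_(0 <= k < n) dot (d n) (f k) *: f k in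
  f n = (rnorm r)^-1%:C *: r.
Proof.
pose f n := nth 0 (gram_schmidt_seq d n.+1) n.
have sz n : size (gram_schmidt_seq d n) = n.
  by elim: n => //= n IHn; rewrite size_rcons IHn.
pose r n := d n - \sum_(v <- gram_schmidt_seq d n) dot (d n) v *: v.
have fr n : f n = (rnorm (r n))^-1%:C *: r n.
  by rewrite /f -[gram_schmidt_seq d n.+1]/(rcons _ _) nth_rcons sz ltnn eqxx.
have gsS n : gram_schmidt_seq d n.+1 = rcons (gram_schmidt_seq d n) (f n).
  by rewrite fr.
have sE n : gram_schmidt_seq d n = map f (index_iota 0 n).
  rewrite /index_iota subn0; elim: n => // n IHn.
  by rewrite gsS -[in RHS]addn1 iotaD map_cat -IHn add0n cats1.
by exists f => n; rewrite fr /r sE big_map.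
Qed.

(** The quantification over every subspace [E] encodes equality of the two linear spans. It is
    applied both to spans and to orthogonal complements. *)
Lemma gram_schmidt d : exists f, orthonormal_or_zero dot f /\
  forall E, subspace E -> (forall n, E (d n)) <-> (forall n, E (f n)).
Proof.
have [f fE] := gram_schmidt_rec d; exists f; split; last first.
  move=> E sE; split=> Ed n.
    elim/ltn_ind: n => n IHn; rewrite fE; apply: subspaceZ => //.
    by apply: subspaceB => //; apply: subspace_sum => // k /andP[_]; exact: IHn.
  pose r := d n - \sum_(0 <= k < n) dot (d n) (f k) *: f k.
  rewrite -(subrK (\sum_(0 <= k < n) dot (d n) (f k) *: f k) (d n)) -/r.
  have -> : r = (rnorm r)%:C *: f n.
    rewrite fE -/r scalerA -rmorphM/=.
    have [->|r0] := eqVneq r 0; first by rewrite !scaler0.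
    by rewrite divff ?scale1r// rnorm_eq0.
  by apply: sE.2 => //; exact: subspace_sum.
(* truncating [f] makes the induction hypothesis an instance of [dot_fourier_sum] *)
pose F n k := if (k < n)%N then f k else 0.
have FP n : orthonormal_or_zero dot (F n).
  elim: n => [|n IHn]; first by split=> [i j _|i]; rewrite /F ?dot0l//; left.
  pose r := d n - \sum_(0 <= k < n) dot (d n) (f k) *: f k.
  have rf j : (j < n)%N -> dot r (f j) = 0.
    move=> jn; rewrite dotBl; apply/eqP; rewrite subr_eq0; apply/eqP.
    have := dot_fourier_sum (d n) n j IHn; rewrite /F jn => <-; congr (dot _ _).
    by apply: eq_big_nat => k /andP[_ ->].
  have fnj j : (j < n)%N -> dot (f n) (f j) = 0.
    by move=> jn; rewrite fE dotZl -/r rf ?mulr0.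
  split=> [i j ij|i].
    rewrite /F !ltnS; case: (ltngtP i n) => [i_n|_|i_n]; rewrite ?dot0l//.
      case: (ltngtP j n) => [j_n|_|->]; rewrite ?dot0r//.
        by have := IHn.1 i j ij; rewrite /F i_n j_n.
      by rewrite dot_eq0C// fnj.
    case: (ltngtP j n) => [j_n|_|jn]; rewrite ?dot0r ?i_n ?fnj//.
    by move: ij; rewrite i_n jn eqxx.
  rewrite /F ltnS; case: (ltngtP i n) => [i_n|_|->].
  - by have := IHn.2 i; rewrite /F i_n.
  - by left.
  - rewrite fE -/r; have [->|r0] := eqVneq r 0; first by left; rewrite scaler0.
    right; rewrite dotZl dotZr (dotxx norm_dot) conjc_real -!rmorphM/=.
    by rewrite mulrA -expr2 -exprMn mulVf ?expr1n// rnorm_eq0.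
split=> [i j ij|i].
  have := (FP (maxn i j).+1).1 i j ij.
  by rewrite /F !ltnS leq_maxl leq_maxr.
by have := (FP i.+1).2 i; rewrite /F ltnSn.
Qed.

(** Gram-Schmidt applied to [g] itself turns the projection on its closed span into the sum of a
    Fourier series. *)
Lemma span_projection g x :
  exists2 p, closed_span g p & forall k, dot (x - p) (g k) = 0.
Proof.
have [f [fo fE]] := gram_schmidt g.
have [p [sp xp _]] := fourier_projection norm_dot x fo.
exists p; last by apply/(fE _ (subspace_orthl _)).
apply: (@closure_subspace_lim (lin_span g) _ _ _ sp) => n.
apply: (subspace_sum _ (subspace_lin_span g)) => k _.
by move: k; apply/(fE _ (subspace_lin_span g)) => k; exact: lin_span_mem.
Qed.

Lemma separable_dense_sequence : separable H ->
  exists d, forall x (e : R), 0 < e -> exists n, rnorm (x - d n) < e.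
Proof.
move=> [D /countable_injP[i iD] dD].
(* The default value 0 may lie outside [D]; this is harmless, since each [y] in [D] is still reached
   at index [i y]. *)
pose d n := xget 0 [set x | D x /\ i x = n]; exists d => x e e0.
have [|y [xy Dy]] := dD (ball x e%:C) _ (ball_open _ _).
  by exists x; apply: ballxx; rewrite ltcR.
have dy : d (i y) = y.
  rewrite /d; case: xgetP => [z -> [Dz iz]|/(_ y)]; last by case.
  by apply: iD => //; rewrite inE.
by exists (i y); rewrite dy; move: xy; rewrite -ball_normE/= rnormE ltcR.
Qed.

Lemma orthogonal_complement_basis g : separable H ->
  exists f, [/\ orthonormal_or_zero dot f, forall i k, dot (f i) (g k) = 0 &
    forall h, exists p, [/\ closed_span g p, forall k, dot (h - p) (g k) = 0 &
      \sum_(0 <= k < n) rnorm (dot h (f k)) ^+ 2 @[n --> \oo] --> rnorm (h - p) ^+ 2]].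
Proof.
move=> /separable_dense_sequence[d dd].
have /choice[P PE] : forall x, exists p,
    closed_span g p /\ forall k, dot (x - p) (g k) = 0.
  by move=> x; have [p] := span_projection g x; exists p.
have [f [fo fE]] := gram_schmidt (fun n => d n - P (d n)).
pose gperp := [set y | forall k, dot y (g k) = 0].
have gperp_sub : subspace gperp.
  split=> [k|c x y xg yg k]/=; first by rewrite dot0l.
  by rewrite dotDl dotZl xg yg mulr0 addr0.
have fg : forall i, gperp (f i) by apply/(fE _ gperp_sub) => n; have [] := PE (d n).
exists f; split => // h; exists (P h); have [hP hPg] := PE h; split => //.
have [q [sq hq lq]] := fourier_projection norm_dot h fo.
(* [r] is orthogonal to every [g k] and every [f j], hence to every [d n], and a vector orthogonal
   to a dense sequence vanishes. *)
pose r := h - P h - q.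
have rg k : dot r (g k) = 0.
  rewrite dotBl hPg sub0r (dot_lim norm_dot sq (c := 0)) ?oppr0//.
  by apply: nearW => n; rewrite /series/= dot_suml big1// => j _; rewrite dotZl fg mulr0.
have rf j : dot r (f j) = 0.
  rewrite /r addrAC dotBl hq sub0r (closed_span_orth _ hP) ?oppr0// => k.
  exact/dot_eq0C/fg.
have rd n : dot r (d n) = 0.
  rewrite -(subrK (P (d n)) (d n)) dotDr.
  have -> : dot r (d n - P (d n)) = 0.
    by move: n; apply/(fE _ (subspace_orthl r)).
  rewrite add0r dot_eq0C// (@closed_span_orth g)//; last by have [] := PE (d n).
  by move=> k; exact/dot_eq0C.
suff r0 : r = 0 by rewrite (_ : h - P h = q)//; apply/eqP; rewrite -subr_eq0 -/r r0.
apply/eqP; rewrite -rnorm_eq0 eq_le rnorm_ge0 andbT.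
apply/ler_addgt0Pl => e e0; rewrite addr0; have [n rn] := dd r e e0.
have [->|rn0] := eqVneq (rnorm r) 0; first exact: ltW.
have rgt0 : 0 < rnorm r by rewrite lt_neqAle eq_sym rn0 rnorm_ge0.
rewrite -(ler_pM2l rgt0) (le_trans _ (ler_wpM2l (rnorm_ge0 r) (ltW rn)))//.
apply: le_trans (cauchy_schwarz norm_dot _ _).
by rewrite dotBr rd subr0 (dotxx norm_dot) rnormC -expr2 ler_norm.
Qed.

End Subspaces.

Lemma nneseries_EFin (R : realType) (a : nat -> R) (s : R) :
  \sum_(0 <= k < n) a k @[n --> \oo] --> s ->
  (\sum_(0 <= k <oo) (a k)%:E)%E = s%:E.
Proof.
move=> sa; apply: cvg_lim => //.
rewrite [X in X @ _](_ : _ = EFin \o (fun n => \sum_(0 <= k < n) a k)); last first.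
  by apply/funext => n /=; rewrite sumEFin.
by apply/fine_cvgP; split => //; exact: nearW.
Qed.

(** * The frame operator *)

Section Frames.
Variables (R : realType) (H : completeNormedModType R[i]).
Variable dot : {dot H for Num.conj}.
Hypothesis norm_dot : forall x : H, `|x| ^+ 2 = dot x x.
Implicit Types (x y z h : H) (g f d : nat -> H) (E : set H) (B : R).

Lemma cvg_seq_unique (u : nat -> H) x y :
  u n @[n --> \oo] --> x -> u n @[n --> \oo] --> y -> x = y.
Proof. exact: (cvg_unique (@norm_hausdorff _ H)). Qed.

Lemma bessel_boundP g B :
  (forall h, (coef_energy dot g h <= (B * rnorm h ^+ 2)%:E)%E) -> bessel_bound dot g B.
Proof.
move=> gB h n; rewrite -lee_fin (le_trans _ (gB h))// -sumEFin.
by apply: nneseries_lim_ge => k _ _; rewrite lee_fin sqr_ge0.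
Qed.

Lemma coef_energy_cvg g B h : bessel_bound dot g B ->
  exists s : R, [/\ \sum_(0 <= k < n) rnorm (dot h (g k)) ^+ 2 @[n --> \oo] --> s,
    coef_energy dot g h = s%:E & s <= B * rnorm h ^+ 2].
Proof.
move=> gB; set a := fun n => \sum_(0 <= k < n) rnorm (dot h (g k)) ^+ 2.
have nd : nondecreasing_seq a.
  move=> n m nm; rewrite /a (big_cat_nat (leq0n n) nm)//= lerDl sumr_ge0// => k _.
  by rewrite sqr_ge0.
have ca : cvgn a.
  by apply: nondecreasing_is_cvgn => //; exists (B * rnorm h ^+ 2) => _ [n _ <-]; exact: gB.
exists (limn a); split => //; first exact: nneseries_EFin.
by apply: limr_le => //; apply: nearW => n; exact: gB.
Qed.

Section FrameOperator.
Variables (g : nat -> H) (B : R).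
Hypotheses (B0 : 0 < B) (gB : bessel_bound dot g B).

Let expansion x n := series (fun k => dot x (g k) *: g k) n.

(** For the last clause, a partial sum [e] has inner product [sn] with [x], and
    [rnorm e ^+ 2 <= B * sn] by [bessel_synthesis]. Expanding the square leaves
    [rnorm x ^+ 2 - sn / B], and [sn] tends to [s]. With a lower frame bound this clause becomes a
    contraction estimate. *)
Lemma frame_operator : exists S : H -> H,
  [/\ forall x, expansion x n @[n --> \oo] --> S x,
      forall c x y, S (x - c *: y) = S x - c *: S y,
      forall x, rnorm (S x) <= B * rnorm x &
      forall x s, coef_energy dot g x = s%:E ->
        rnorm (x - B^-1%:C *: S x) ^+ 2 <= rnorm x ^+ 2 - s / B].
Proof.
have /choice[S SE] x := bessel_series_cvg norm_dot B0 gB (gB x).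
exists S; split => //.
- move=> c x y; have cl : (fun n => expansion x n - c *: expansion y n) @ \oo -->
      S x - c *: S y.
    by apply: cvgB (SE x) _; apply: cvgZl_tmp; exact: SE.
  rewrite (_ : (fun n => _) = expansion (x - c *: y)) in cl.
    exact: cvg_seq_unique (SE _) cl.
  apply/funext => n; rewrite /expansion /series/= scaler_sumr -sumrB.
  by apply: eq_bigr => k _; rewrite dotBl dotZl scalerBl scalerA.
- move=> x; rewrite -ler_sqr ?nnegrE ?mulr_ge0 ?rnorm_ge0 ?(ltW B0)//.
  apply: (ler_cvg_to (cvg_sqr_rnorm (SE x)) (cvg_cst _)).
  apply: nearW => n; rewrite (le_trans (bessel_synthesis _ _ _ _ B0 gB))//.
  by rewrite exprMn expr2 -mulrA ler_pM2l.
- move=> x s xs; have [s' [ss' + _]] := coef_energy_cvg x gB.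
  rewrite xs => -[ss]; move: ss'; rewrite -{}ss => {s'} ss.
  have cl : rnorm (x - B^-1%:C *: expansion x n) ^+ 2 @[n --> \oo] -->
      rnorm (x - B^-1%:C *: S x) ^+ 2.
    by apply: cvg_sqr_rnorm; apply: cvgB; [exact: cvg_cst|apply: cvgZl_tmp; exact: SE].
  have cr : rnorm x ^+ 2 - (\sum_(0 <= k < n) rnorm (dot x (g k)) ^+ 2) / B
      @[n --> \oo] --> rnorm x ^+ 2 - s / B.
    by apply: cvgB; [exact: cvg_cst|apply: cvgMl].
  apply: (ler_cvg_to cl cr); apply: nearW => n.
  set e := expansion x n; set sn := \sum_(_ <= _ < _) _.
  have e2 : rnorm e ^+ 2 <= B * sn by exact: bessel_synthesis.
  have xe : complex.Re (dot x (- (B^-1%:C *: e))) = - (sn / B).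
    rewrite -scaleNr dotZr /e /expansion /series/= dot_sumr.
    rewrite (_ : \sum_(0 <= k < n) _ = sn%:C); last first.
      rewrite /sn raddf_sum/=; apply: eq_bigr => k _.
      by rewrite dotZr mulrC -sqr_normc rnormE -rmorphXn.
    by rewrite /=; ring.
  rewrite (sqr_rnormD norm_dot) xe rnormN rnormZ rnormC exprMn.
  rewrite (ger0_norm (ltW _)) ?invr_gt0//.
  have : B^-1 ^+ 2 * rnorm e ^+ 2 <= sn / B.
    rewrite (le_trans (ler_wpM2l _ e2)) ?sqr_ge0//.
    by rewrite mulrA expr2 mulrVK ?unitfE ?gt_eqF// mulrC.
  lra.
Qed.

(** Surjectivity of the frame operator on the closed subspace [E]: the solution [y] of [S y = x] is
    the Neumann series of [K = 1 - S / B], a strict contraction on [E]. *)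
Lemma frame_expansion E A : subspace E -> closure E `<=` E -> (forall k, E (g k)) ->
  0 < A -> (forall x, E x -> ((A * rnorm x ^+ 2)%:E <= coef_energy dot g x)%E) ->
  forall x, E x -> exists2 y, E y & expansion y n @[n --> \oo] --> x.
Proof.
move=> sE cE Eg A0 gA x Ex.
have [S [SE SB Sle SK]] := frame_operator.
have ES z : E (S z).
  apply: cE; apply: closure_subspace_lim (SE z) => n.
  by apply: subspace_sum => // k _.
(* Richardson iteration: [K] contracts by [q], as [1 - a / B <= (1 - a / (2 B)) ^ 2];
   the minimum covers [E = 0], where [A <= B] may fail. *)
pose q := 1 - Num.min A B / (2 * B).
have mB : 0 < Num.min A B / (2 * B) <= 2^-1.
  rewrite divr_gt0 ?lt_min ?A0 ?mulr_gt0//=.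
  by rewrite ler_pdivrMr ?mulr_gt0// mulKf// ge_min lexx orbT.
have q01 : 0 <= q < 1 by rewrite /q; lra.
pose K z := z - B^-1%:C *: S z.
have EK z : E z -> E (K z).
  by move=> Ez; apply: subspaceB => //; exact: subspaceZ.
have Kq z : E z -> rnorm (K z) <= q * rnorm z.
  move=> Ez; rewrite -ler_sqr ?nnegrE ?mulr_ge0 ?rnorm_ge0//; last by lra.
  have [s [_ zs _]] := coef_energy_cvg z gB.
  have := SK _ _ zs => /le_trans; apply.
  have := gA _ Ez; rewrite zs lee_fin => As.
  have : Num.min A B / B * rnorm z ^+ 2 <= s / B.
    rewrite mulrAC ler_wpM2r ?invr_ge0 ?(ltW B0)//.
    by apply: le_trans As; rewrite ler_wpM2r ?sqr_ge0// ge_min lexx.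
  rewrite exprMn; have -> : Num.min A B / B = 2 * (1 - q) by rewrite /q; field; rewrite gt_eqF.
  have := mulr_ge0 (sqr_ge0 (1 - q)) (sqr_ge0 (rnorm z)); lra.
pose r n := iter n K x.
have Er n : E (r n) by elim: n => //= n; exact: EK.
have rq n : rnorm (r n) <= q ^+ n * rnorm x.
  elim: n => [|n IHn]; first by rewrite expr0 mul1r.
  rewrite exprS -mulrA (le_trans (Kq _ (Er n)))// ler_wpM2l//; lra.
pose y n := \sum_(0 <= k < n) B^-1%:C *: r k.
have Bi : 0 <= B^-1 by rewrite invr_ge0 ltW.
(* The increments of [y] are dominated by a geometric series of ratio [q], so [y] is Cauchy. *)
have [e e0|yl yyl] := @cauchy_rnorm_cvg _ _ y.
  have [||N hN] := @bounded_series_tail _ (fun k => B^-1 * (q ^+ k * rnorm x))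
     (B^-1 * (rnorm x / (1 - q))) _ _ e e0.
  - by move=> k; rewrite !mulr_ge0 ?rnorm_ge0 ?exprn_ge0//; lra.
  - move=> n; rewrite -mulr_sumr ler_wpM2l// -mulr_suml mulrC ler_wpM2l ?rnorm_ge0//.
    rewrite -[leRHS]mul1r ler_pdivlMr; last by lra.
    rewrite mulrC big_mkord -opprB mulNr -subrX1 opprB gerBl exprn_ge0//; lra.
  - exists N => n m Nn nm; apply: le_lt_trans (hN _ _ Nn nm).
    rewrite /y (big_cat_nat (leq0n n) nm)//= addrAC subrr add0r.
    rewrite (le_trans (rnorm_sum _ _ _))//; apply: ler_sum => k _.
    by rewrite rnormZ rnormC ger0_norm// ler_wpM2l.
have Ey n : E (y n) by apply: subspace_sum => // k _.
exists yl; first by apply: cE; exact: closure_subspace_lim Ey yyl.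
suff <- : S yl = x by exact: SE.
have S0 : S 0 = 0 by have := SB 1 x x; rewrite !scale1r !subrr.
have xS n : x - S (y n) = r n.
  elim: n => [|n IHn]; first by rewrite /y big_geq// S0 subr0.
  rewrite /= /K -IHn.
  have -> : y n.+1 = y n - (- B^-1%:C) *: r n.
    by rewrite scaleNr opprK /y big_nat_recr.
  by rewrite SB IHn scaleNr opprK opprD addrA IHn.
(* The residual [x - S (y n)] is a multiple of an increment of a convergent sequence, so it tends to
   zero. *)
have rB n : r n = B%:C *: (y n.+1 - y n).
  rewrite /y big_nat_recr//= addrAC subrr add0r scalerA -rmorphM/=.
  by rewrite divff ?gt_eqF// scale1r.
apply/eqP; rewrite -subr_eq0 -rnorm_eq0 eq_le rnorm_ge0 andbT.
apply/ler_addgt0Pl => e e0; rewrite addr0.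
(* Three distances to [yl], each multiplied by [B], enter the final estimate: one from [le1] and two
   from [le2]. *)
have eB : 0 < e / (3 * B) by rewrite divr_gt0// mulr_gt0.
have [N _ hN] := (cvg_rnormP _ _).1 yyl _ eB.
have yN := hN N (leqnn N); have yN1 := hN N.+1 (leqnSn N).
have -> : S yl - x = (S yl - S (y N)) - r N by rewrite -xS opprB addrA subrK.
rewrite (le_trans (rnormB _ _))//.
have le1 : rnorm (S yl - S (y N)) <= B * rnorm (yl - y N).
  by rewrite -[S (y N)]scale1r -SB scale1r Sle.
have le2 : rnorm (r N) <= B * (rnorm (yl - y N) + rnorm (yl - y N.+1)).
  rewrite rB rnormZ rnormC (ger0_norm (ltW B0)) ler_wpM2l ?(ltW B0)//.
  rewrite (_ : y N.+1 - y N = (yl - y N) - (yl - y N.+1)) ?rnormB//.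
  by rewrite opprB [RHS]addrC addrA subrK.
have : B * (rnorm (yl - y N) + (rnorm (yl - y N) + rnorm (yl - y N.+1))) <= B * (e / B).
  rewrite ler_wpM2l ?(ltW B0)//.
  have -> : e / B = e / (3 * B) + (e / (3 * B) + e / (3 * B)) by field; rewrite gt_eqF.
  by rewrite !lerD// ltW.
rewrite [B * (e / B)]mulrC divfK ?gt_eqF//; lra.
Qed.
End FrameOperator.
End Frames.

(** * Consecutive blocks of indices *)

(** The vector with all entries [w] on the block is a unit vector and [y] is the component of [x]
    along it. Replacing that component by [t] changes the squared norm by [t ^+ 2 - y ^+ 2]. *)
Lemma block_sum_shift (R : realType) (x : nat -> R) (w t : R) m n : (m <= n)%N ->
  w ^+ 2 * (n - m)%:R = 1 ->
  let y := w * \sum_(m <= k < n) x k in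
  \sum_(m <= k < n) (x k + w * (t - y)) ^+ 2 =
    \sum_(m <= k < n) x k ^+ 2 + t ^+ 2 - y ^+ 2.
Proof.
move=> mn wn y.
rewrite (eq_bigr (fun k => x k ^+ 2 + ((2 * w * (t - y)) * x k + w ^+ 2 * (t - y) ^+ 2))).
  rewrite !big_split/= -[X in _ + (X + _)]mulr_sumr sumr_const_nat -[_ *+ (n - m)]mulr_natr.
  have -> : 2 * w * (t - y) * \sum_(m <= k < n) x k = 2 * y * (t - y).
    by rewrite /y; ring.
  rewrite [w ^+ 2 * _ * _]mulrAC wn mul1r; ring.
by move=> k _; ring.
Qed.

Lemma sum_blocks (V : nmodType) (s : nat -> nat) (F : nat -> V) n :
  s 0%N = 0%N -> (forall j, (s j <= s j.+1)%N) ->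
  \sum_(0 <= k < s n) F k = \sum_(0 <= j < n) \sum_(s j <= k < s j.+1) F k.
Proof.
move=> s0 smono; elim: n => [|n IHn]; first by rewrite s0 !big_geq.
by rewrite (big_cat_nat (leq0n _) (smono n))//= IHn big_nat_recr.
Qed.

(** A strictly increasing [s] satisfies [j <= s j], so there is a largest [j] with [s j <= k]; this
    is [b k]. *)
Lemma block_index (s : nat -> nat) :
  s 0%N = 0%N -> (forall j, (s j < s j.+1)%N) ->
  exists b : nat -> nat, forall j k, (s j <= k < s j.+1)%N = (b k == j).
Proof.
move=> s0 smono; have sle : {homo s : i j / (i <= j)%N}.
  by apply: homo_leq => // [i j k|i]; [exact: leq_trans|exact: ltnW].
have sk k : (k <= s k)%N.
  by elim: k => // k IHk; exact: leq_ltn_trans IHk (smono k).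
have /choice[b bP] : forall k, exists j, (s j <= k < s j.+1)%N.
  move=> k; have ex : exists j, (s j <= k)%N by exists 0%N; rewrite s0.
  have bnd j : (s j <= k)%N -> (j <= k)%N by exact: leq_trans.
  case: (ex_maxnP ex bnd) => j sj jmax; exists j; rewrite sj ltnNge.
  by apply/negP => /jmax; rewrite ltnn.
exists b => j k; apply/idP/eqP => [/andP[sjk ksj]|<-]; last exact: bP.
have /andP[sbk ksb] := bP k; apply/eqP; rewrite eqn_leq; apply/andP; split.
  by rewrite -ltnS ltnNge; apply/negP => /sle; rewrite leqNgt (leq_ltn_trans sbk).
by rewrite -ltnS ltnNge; apply/negP => /sle; rewrite leqNgt (leq_ltn_trans sjk).
Qed.

(** * Block perturbation *)

Section BlockShift.
Variables (R : realType) (H : completeNormedModType R[i]).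
Variable dot : {dot H for Num.conj}.
Hypothesis norm_dot : forall x : H, `|x| ^+ 2 = dot x x.
Implicit Types (h : H) (g f phi : nat -> H) (B : R).

Variables (s b : nat -> nat) (w : nat -> R) (sigma : nat -> bool * nat).
Hypotheses (s0 : s 0%N = 0%N) (smono : forall j, (s j < s j.+1)%N).
Hypothesis bE : forall j k, (s j <= k < s j.+1)%N = (b k == j).
Hypothesis wE : forall j, w j ^+ 2 * (s j.+1 - s j)%:R = 1.

(* [T u_j] in the notation of the header; [w j] is the reciprocal root of the length of
   the block [s j, s j.+1), and [b k] is the index of the block that contains [k]. *)
Definition block_vector g j : H := (w j)%:C *: \sum_(s j <= k < s j.+1) g k.

(* [(true, n)] stands for [T u_n] and [(false, i)] for [f i]. *)
Definition block_target g f (p : bool * nat) : H :=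
  if p.1 then block_vector g p.2 else f p.2.

(** This is [psi_k]: as [e_k] has coefficient [w (b k)] on the unit vector of its block, moving the
    image of that unit vector changes [g k] by this multiple of the displacement. *)
Definition block_shift g f k : H :=
  g k + (w (b k))%:C *: (block_target g f (sigma (b k)) - block_vector g (b k)).

Lemma dot_block_vector h g j :
  dot h (block_vector g j) = (w j)%:C * \sum_(s j <= k < s j.+1) dot h (g k).
Proof. by rewrite dotZr conjc_real dot_sumr. Qed.

Lemma block_vector_energy h g j :
  rnorm (dot h (block_vector g j)) ^+ 2 <=
  \sum_(s j <= k < s j.+1) rnorm (dot h (g k)) ^+ 2.
Proof.
rewrite dot_block_vector; set x := fun k => dot h (g k).
under [leRHS]eq_bigr do rewrite sqr_rnorm -/(x _).
(* Taking [t = 0] in [block_sum_shift] leaves a sum of squares, which is nonnegative. Real and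
   imaginary parts are treated separately because that identity is real. *)
have key (y : nat -> R) : (w j * \sum_(s j <= k < s j.+1) y k) ^+ 2 <=
    \sum_(s j <= k < s j.+1) y k ^+ 2.
  have := block_sum_shift y 0 (ltnW (smono j)) (wE j) => /=.
  rewrite expr0n/= addr0 => /eqP; rewrite -subr_eq0 => /eqP.
  have : 0 <= \sum_(s j <= k < s j.+1) (y k + w j * (0 - w j * \sum_(s j <= k < s j.+1) y k)) ^+ 2.
    by rewrite sumr_ge0// => k _; rewrite sqr_ge0.
  lra.
rewrite sqr_rnorm big_split/=.
have -> : complex.Re ((w j)%:C * \sum_(s j <= k < s j.+1) x k) =
    w j * \sum_(s j <= k < s j.+1) complex.Re (x k).
  rewrite -(raddf_sum (@complex.Re R : Rcomplex R -> R)).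
  by case: (\sum_(_ <= _ < _) _) => p q /=; ring.
have -> : complex.Im ((w j)%:C * \sum_(s j <= k < s j.+1) x k) =
    w j * \sum_(s j <= k < s j.+1) complex.Im (x k).
  rewrite -(raddf_sum (@complex.Im R : Rcomplex R -> R)).
  by case: (\sum_(_ <= _ < _) _) => p q /=; ring.
exact: lerD.
Qed.

(** On the block, [dot h (block_shift g f k)] has real and imaginary parts of the form treated by
    [block_sum_shift], with [t] and [y] the coefficients at the new and old block vector. *)
Lemma block_shift_energy h g f j :
  \sum_(s j <= k < s j.+1) rnorm (dot h (block_shift g f k)) ^+ 2 =
  \sum_(s j <= k < s j.+1) rnorm (dot h (g k)) ^+ 2 +
  rnorm (dot h (block_target g f (sigma j))) ^+ 2 -
  rnorm (dot h (block_vector g j)) ^+ 2.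
Proof.
set t := dot h (block_target g f (sigma j)); set y := dot h (block_vector g j).
set x := fun k => dot h (g k).
have Rey : complex.Re y = w j * \sum_(s j <= k < s j.+1) complex.Re (x k).
  rewrite /y dot_block_vector -(raddf_sum (@complex.Re R : Rcomplex R -> R)).
  by case: (\sum_(_ <= _ < _) _) => p q /=; ring.
have Imy : complex.Im y = w j * \sum_(s j <= k < s j.+1) complex.Im (x k).
  rewrite /y dot_block_vector -(raddf_sum (@complex.Im R : Rcomplex R -> R)).
  by case: (\sum_(_ <= _ < _) _) => p q /=; ring.
rewrite (eq_big_nat _ _ (F2 := fun k =>
  (complex.Re (x k) + w j * (complex.Re t - complex.Re y)) ^+ 2 +
  (complex.Im (x k) + w j * (complex.Im t - complex.Im y)) ^+ 2)); last first.
  move=> k; rewrite bE => /eqP bkj; rewrite sqr_rnorm.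
  rewrite /block_shift bkj dotDr dotZr conjc_real dotBr -/t -/y -/(x k).
  by case: t (x k) y {Rey Imy} => [t1 t2] [x1 x2] [y1 y2] /=; congr (_ ^+ 2 + _ ^+ 2); ring.
under [in RHS]eq_bigr do rewrite sqr_rnorm.
rewrite !big_split/= Rey Imy !(block_sum_shift _ _ (ltnW (smono j)) (wE j)).
rewrite (sqr_rnorm t) (sqr_rnorm y) -Rey -Imy; ring.
Qed.

Lemma block_vector_bessel g B : bessel_bound dot g B -> bessel_bound dot (block_vector g) B.
Proof.
move=> gB h n; apply: le_trans (gB h (s n)).
rewrite (sum_blocks _ _ s0 (fun j => ltnW (smono j))).
by apply: ler_sum => j _; exact: block_vector_energy.
Qed.


(** The terms are nonnegative, so the sum may be rearranged along [sigma] and split by the tag. The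
    indices with [f i = 0], which [sigma] omits, contribute nothing. *)
Lemma block_target_energy h g f :
  set_bij setT [set p : bool * nat | p.1 \/ f p.2 <> 0] sigma ->
  (coef_energy dot (fun j => block_target g f (sigma j)) h =
   coef_energy dot (block_vector g) h + coef_energy dot f h)%E.
Proof.
move=> sbij; pose a p := (rnorm (dot h (block_target g f p)) ^+ 2)%:E.
have a0 p : (0 <= a p)%E by rewrite lee_fin sqr_ge0.
rewrite /coef_energy !nneseries_esumT; do ?by move=> n; rewrite lee_fin sqr_ge0.
rewrite -(reindex_esum _ _ sigma a sbij).
rewrite (esumID [set p : bool * nat | p.1])//; congr (_ + _)%E.
  rewrite (reindex_esum setT _ (pair true))//.
  by split=> [n _|m n _ _ []//|[[] n] [_ //] _] /=; split => //; left.
rewrite (reindex_esum [set i | f i <> 0] _ (pair false))//; last first.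
  split=> [n fn|m n _ _ []//|[[] n] [[//|fn] nb]] /=; first by split => //; right.
    by case: nb.
  by exists n.
rewrite esum_mkcond; apply: eq_esum => i _.
case: ifPn => // /negP; rewrite inE/= => fi.
have -> : f i = 0 by apply: contrapT.
by rewrite dot0r rnorm0 expr0n.
Qed.

Let sge n : (n <= s n)%N.
Proof. by elim: n => // n IHn; exact: leq_ltn_trans IHn (smono n). Qed.

(** Summed over the blocks, [block_shift_energy] adds the energy of the targets and removes that of
    the block vectors; by [block_target_energy] the difference is the energy of [f]. *)
Lemma block_shift_coef_energy h g f B : bessel_bound dot g B ->
  orthonormal_or_zero dot f ->
  set_bij setT [set p : bool * nat | p.1 \/ f p.2 <> 0] sigma ->
  (coef_energy dot (block_shift g f) h = coef_energy dot g h + coef_energy dot f h)%E.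
Proof.
move=> gB fo sbij; have vB := block_vector_bessel gB.
have fB := orthonormal_bessel norm_dot fo.
have tB : bessel_bound dot (fun j => block_target g f (sigma j)) (B + 1).
  apply: bessel_boundP => h'; rewrite block_target_energy//.
  have [Y [_ -> Y1]] := coef_energy_cvg h' vB.
  have [Z [_ -> Z1]] := coef_energy_cvg h' fB.
  by rewrite -EFinD lee_fin mulrDl lerD.
have sumE h' n : \sum_(0 <= k < s n) rnorm (dot h' (block_shift g f k)) ^+ 2 =
    \sum_(0 <= k < s n) rnorm (dot h' (g k)) ^+ 2 +
    \sum_(0 <= j < n) rnorm (dot h' (block_target g f (sigma j))) ^+ 2 -
    \sum_(0 <= j < n) rnorm (dot h' (block_vector g j)) ^+ 2.
  rewrite !(sum_blocks _ _ s0 (fun j => ltnW (smono j))) -big_split/= -sumrB.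
  by apply: eq_bigr => j _; exact: block_shift_energy.
(* Dropping the subtracted sum gives a crude bound. It makes the energy of the shifted sequence
   converge, so that the limit can be read off along the subsequence [s n]. *)
have psiB : bessel_bound dot (block_shift g f) (B + (B + 1)).
  move=> h' n.
  apply: (@le_trans _ _ (\sum_(0 <= k < s n) rnorm (dot h' (block_shift g f k)) ^+ 2)).
    rewrite [leRHS](big_cat_nat (leq0n n) (sge n))//= lerDl sumr_ge0// => k _.
    by rewrite sqr_ge0.
  rewrite sumE mulrDl -[leRHS]subr0 lerB ?lerD ?gB ?tB// sumr_ge0// => j _.
  by rewrite sqr_ge0.
have [S [Scvg -> _]] := coef_energy_cvg h psiB.
have [X [Xcvg -> _]] := coef_energy_cvg h gB.
have [T [Tcvg TE _]] := coef_energy_cvg h tB.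
have [Y [Ycvg YE _]] := coef_energy_cvg h vB.
have [Z [_ ZE _]] := coef_energy_cvg h fB.
have TYZ : T = Y + Z.
  by move: TE; rewrite block_target_energy// YE ZE -EFinD => -[].
have s_oo : s n @[n --> \oo] --> \oo.
  by apply/cvgnyPge => A; exists A => // n /= An; exact: leq_trans An (sge n).
have Xs := cvg_comp _ _ s_oo Xcvg; have Ss := cvg_comp _ _ s_oo Scvg.
have : \sum_(0 <= k < s n) rnorm (dot h (g k)) ^+ 2 +
    \sum_(0 <= j < n) rnorm (dot h (block_target g f (sigma j))) ^+ 2 -
    \sum_(0 <= j < n) rnorm (dot h (block_vector g j)) ^+ 2 @[n --> \oo] --> X + T - Y.
  by apply: cvgB Ycvg; exact: cvgD.
under eq_fun do rewrite -sumE.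
move=> /(cvg_unique (@norm_hausdorff _ R) Ss) ->.
by rewrite ZE TYZ -EFinD; congr EFin; lra.
Qed.

Lemma block_vector_norm g B j : 0 < B -> bessel_bound dot g B ->
  rnorm (block_vector g j) ^+ 2 <= B.
Proof.
move=> B0 gB; rewrite /block_vector scaler_sumr.
rewrite (le_trans (bessel_synthesis norm_dot (fun=> (w j)%:C) _ _ B0 gB))//.
rewrite sumr_const_nat rnormC -[_ *+ _]mulr_natr.
by rewrite real_normK ?num_real// wE mulr1.
Qed.

Lemma block_shift_dist g f B k : 0 < B -> bessel_bound dot g B ->
  orthonormal_or_zero dot f ->
  rnorm (g k - block_shift g f k) <= `|w (b k)| * (2 * (B + 1)).
Proof.
move=> B0 gB fo; rewrite rdistC /block_shift addrAC subrr add0r rnormZ rnormC.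
rewrite ler_wpM2l//.
(* [B + 1] dominates both the square root of [B], needed for the block vectors, and 1, needed for
   [f]. *)
have sq_le (u : R) : 0 <= u -> u ^+ 2 <= B -> u <= B + 1.
  move=> u0 uB; rewrite leNgt; apply/negP => Bu.
  have : u <= u ^+ 2 by rewrite expr2 ler_peMl//; lra.
  lra.
have vB j : rnorm (block_vector g j) <= B + 1.
  by apply: sq_le; [exact: rnorm_ge0|exact: block_vector_norm].
have tB p : rnorm (block_target g f p) <= B + 1.
  rewrite /block_target; case: p.1; first exact: vB.
  have [->|] := fo.2 p.2; first by rewrite rnorm0; lra.
  rewrite (dotxx norm_dot) => -[f1].
  have /eqP := f1; rewrite sqrf_eq1 => /orP[/eqP ->|/eqP f1']; first by lra.
  by have := rnorm_ge0 (f p.2); rewrite f1'; lra.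
by rewrite (le_trans (rnormB _ _))//; have := vB (b k); have := tB (sigma (b k)); lra.
Qed.

(** The block vectors of [g] and [phi] are biorthogonal, and so are the two families of targets,
    which share the orthonormal vectors [f]. In the bilinear expansion all corrections then
    cancel. *)
Lemma block_shift_biorthogonal g phi f :
  (forall j k, dot (g j) (phi k) = (j == k)%:R) ->
  orthonormal_or_zero dot f ->
  (forall i k, dot (f i) (g k) = 0) -> (forall i k, dot (f i) (phi k) = 0) ->
  set_bij setT [set p : bool * nat | p.1 \/ f p.2 <> 0] sigma ->
  forall j k, dot (block_shift g f j) (block_shift phi f k) = (j == k)%:R.
Proof.
move=> gphi fo fg fphi [Ssig Isig _] p q.
have sum_delta m n (F : nat -> nat -> R[i]) j : (forall k, F k j = (k == j)%:R) ->
    \sum_(m <= k < n) F k j = (m <= j < n)%:R.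
  move=> FE; rewrite (eq_bigr (fun k => if k == j then 1 else 0)).
    by rewrite -big_mkcond/= big_nat1_eq; case: ifP.
  by move=> k _; rewrite FE; case: eqP.
have gv j i : dot (g j) (block_vector phi i) = (b j == i)%:R * (w i)%:C.
  rewrite dot_block_vector (sum_delta _ _ (fun k j => dot (g j) (phi k))).
    by rewrite bE mulrC.
  by move=> k; rewrite gphi eq_sym.
have vphi j i : dot (block_vector g i) (phi j) = (b j == i)%:R * (w i)%:C.
  rewrite /block_vector dotZl dot_suml (sum_delta _ _ (fun k j => dot (g k) (phi j))).
    by rewrite bE mulrC.
  by move=> k; rewrite gphi.
have vv i j : dot (block_vector g i) (block_vector phi j) = (i == j)%:R.
  rewrite {1}/block_vector dotZl dot_suml.
  rewrite (eq_big_nat _ _ (F2 := fun k => (i == j)%:R * (w j)%:C)); last first.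
    by move=> k; rewrite bE gv => /eqP ->.
  rewrite sumr_const_nat; have [->|ij] := eqVneq i j; last first.
    by rewrite mul0r mul0rn mulr0.
  rewrite mul1r -[_ *+ (_ - _)]mulr_natr mulrA -expr2 -(rmorph_nat (real_complex R)).
  by rewrite -rmorphXn -rmorphM wE rmorph1.
have fv i j : dot (f i) (block_vector phi j) = 0.
  by rewrite dot_block_vector big1 ?mulr0.
have gf i j : dot (g j) (f i) = 0 by rewrite dot_eq0C.
have vf i j : dot (block_vector g j) (f i) = 0.
  by rewrite dot_eq0C// dot_block_vector big1 ?mulr0.
have gt j (x : bool * nat) :
    dot (g j) (block_target phi f x) = (x == (true, b j))%:R * (w (b j))%:C.
  case: x => -[] n; rewrite /block_target/= ?gf ?mul0r// gv.
  by rewrite xpair_eqE/= eq_sym; case: eqP => [->//|]; rewrite !mul0r.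
have tphi j (x : bool * nat) :
    dot (block_target g f x) (phi j) = (x == (true, b j))%:R * (w (b j))%:C.
  case: x => -[] n; rewrite /block_target/= ?fphi ?mul0r// vphi.
  by rewrite xpair_eqE/= eq_sym; case: eqP => [->//|]; rewrite !mul0r.
have vt j (x : bool * nat) : dot (block_vector g j) (block_target phi f x) = (x == (true, j))%:R.
  by case: x => -[] n; rewrite /block_target/= ?vf// vv xpair_eqE/= eq_sym.
have tv j (x : bool * nat) : dot (block_target g f x) (block_vector phi j) = (x == (true, j))%:R.
  by case: x => -[] n; rewrite /block_target/= ?fv// vv xpair_eqE.
(* [sigma] is injective and reaches only nonzero [f m], whose inner square is 1. *)
have tt i j : dot (block_target g f (sigma i)) (block_target phi f (sigma j)) = (i == j)%:R.
  have -> : (i == j) = (sigma i == sigma j).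
    by apply/eqP/eqP => [->//|]; apply: Isig; rewrite inE.
  have := Ssig i I; have := Ssig j I; case: (sigma i) (sigma j) => [c m] [c' n] /=.
  case: c; first by rewrite {1}/block_target/= vt eq_sym.
  case: c' => [_ _|[//|fn] [//|fm]]; first by rewrite {2}/block_target/= tv.
  rewrite /block_target/= xpair_eqE/=; have [->|mn] := eqVneq m n; last exact: fo.1.
  by have [] := fo.2 n.
have expand (x y z x' y' z' : H) (a c : R) :
    dot (x + a%:C *: (y - z)) (x' + c%:C *: (y' - z')) =
    dot x x' + c%:C * (dot x y' - dot x z') + a%:C * (dot y x' - dot z x') +
    a%:C * c%:C * (dot y y' - dot y z' - dot z y' + dot z z').
  by rewrite !(dotBl, dotBr, dotDl, dotDr, dotZl, dotZr) !conjc_real; ring.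
rewrite /block_shift expand gphi gv gt vphi tphi tv vt tt vv (eq_sym (b q) (b p)).
(* The terms that involve [sigma] cancel in pairs; those with [b p = b q] sum to
   [- w ^+ 2 - w ^+ 2 + 2 * w ^+ 2], where [w] is the weight of the common block. *)
have [->|_] := eqVneq (b p) (b q); rewrite /=; ring.
Qed.

End BlockShift.

(** * Construction of the nearby sequence *)

(** The target set is countable and contains every [(true, n)], so it is countably infinite whether
    [I] is empty, finite or infinite. *)
Lemma infinite_bijection (I : set nat) :
  exists sigma : nat -> bool * nat, set_bij setT [set p : bool * nat | p.1 \/ I p.2] sigma.
Proof.
set S := [set p : bool * nat | _].
have SN : (S #= [set: nat])%card.
  apply: eq_card_nat => // finS; apply: infinite_nat.
  have := @sub_finite_set _ (pair true @` setT) S _ finS.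
  have TS : pair true @` [set: nat] `<=` S by move=> _ [n _ <-]; left.
  move=> /(_ TS) /(finite_image snd); apply: sub_finite_set => n _ /=.
  by exists (true, n) => //; exists n.
by apply/card_set_bijP; rewrite card_eq_sym.
Qed.

Section NearbySequence.
Variables (R : realType) (H : completeNormedModType R[i]).
Variable dot : {dot H for Num.conj}.
Hypothesis norm_dot : forall x : H, `|x| ^+ 2 = dot x x.
Implicit Types (h x p : H) (g f phi psi : nat -> H) (A B : R).

(** One construction serves all three cases: the energy identity yields the bounds and the
    completeness, and the last clause carries a biorthogonal sequence over to [psi] in the Riesz
    case. *)
Lemma nearby_sequence g B (delta : R) :
  separable H -> 0 < B -> bessel_bound dot g B -> 0 < delta ->
  exists psi : nat -> H,
  [/\ forall h, exists p, [/\ closed_span g p, forall k, dot (h - p) (g k) = 0 &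
        (coef_energy dot psi h = coef_energy dot g p + (rnorm (h - p) ^+ 2)%:E)%E],
      rnorm (g k - psi k) @[k --> \oo] --> (0 : R),
      forall k, rnorm (g k - psi k) <= delta &
      forall phi, (forall k, closed_span g (phi k)) ->
        (forall j k, dot (g j) (phi k) = (j == k)%:R) ->
        exists phi', forall j k, dot (psi j) (phi' k) = (j == k)%:R].
Proof.
move=> sepH B0 gB delta0.
have [f [fo fg fE]] := orthogonal_complement_basis norm_dot g sepH.
have [sigma sbij] := infinite_bijection [set i | f i <> 0].
pose C := 2 * (B + 1).
have C0 : 0 < C by rewrite /C; lra.
(* Starting the block lengths at [M.+1 ^ 2] makes even the first weight satisfy [w 0 * C < delta];
   this gives the uniform bound. *)
pose M := Num.truncn (C / delta).
(* square lengths make the weights [w j] rational *)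
pose s n := (\sum_(0 <= i < n) (M + i).+1 ^ 2)%N.
pose w j : R := (M + j).+1%:R^-1.
have sS j : s j.+1 = (s j + (M + j).+1 ^ 2)%N by rewrite /s big_nat_recr.
have s0 : s 0%N = 0%N by rewrite /s big_geq.
have smono j : (s j < s j.+1)%N by rewrite sS -[ltnLHS]addn0 ltn_add2l expn_gt0.
have wE j : w j ^+ 2 * (s j.+1 - s j)%:R = 1.
  by rewrite sS addKn natrX -exprMn mulVf ?expr1n// pnatr_eq0.
have [b bE] := block_index s0 smono.
have w_lt e j : 0 < e -> C / e < (M + j).+1%:R -> `|w j| * C < e.
  move=> e0 Ce; rewrite ger0_norm ?invr_ge0// mulrC ltr_pdivrMr ?ltr0n//.
  by rewrite mulrC -ltr_pdivrMr.
exists (block_shift s b w sigma g f).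
have dist k := block_shift_dist norm_dot b sigma wE k B0 gB fo.
split.
- move=> h; have [p [pg hp lp]] := fE h; exists p; split => //.
  rewrite (block_shift_coef_energy norm_dot s0 smono bE wE h gB fo sbij).
  congr (_ + _)%E; last exact: nneseries_EFin lp.
  apply: eq_eseriesr => k _.
  by have := hp k; rewrite dotBl => /eqP; rewrite subr_eq0 => /eqP ->.
(* From [k >= s N] on, the block index is at least [N], and the weight is below [e / C]. *)
- apply/cvgrPdist_lt => e e0; pose N := Num.truncn (C / e).
  exists (s N) => // k /= sNk; rewrite sub0r normrN ger0_norm ?rnorm_ge0//.
  apply: le_lt_trans (dist k) _; apply: w_lt => //.
  have Nb : (N <= b k)%N.
    have sle : {homo s : i j / (i <= j)%N}.
      by apply: homo_leq => // [i j l|i]; [exact: leq_trans|exact: ltnW].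
    have := bE (b k) k; rewrite eqxx => /andP[_ kb].
    rewrite -ltnS ltnNge; apply/negP => /sle; rewrite leqNgt.
    by rewrite (leq_ltn_trans sNk).
  apply: lt_le_trans (truncnS_gt _) _.
  by rewrite ler_nat ltnS (leq_trans Nb)// leq_addl.
- move=> k; apply: le_trans (dist k) _; apply/ltW/w_lt => //.
  apply: lt_le_trans (truncnS_gt _) _.
  by rewrite ler_nat ltnS leq_addr.
- move=> phi phig gphi; exists (block_shift s b w sigma phi f).
  apply: (block_shift_biorthogonal bE wE gphi fo fg _ sbij) => i k.
  apply: dot_eq0C; apply: (closed_span_orth norm_dot _ (phig k)) => l.
  exact/dot_eq0C/fg.
Qed.

(** * Bessel, frame and Riesz properties from the energy identity *)

Lemma sqr_rnorm_projection g h p : closed_span g p ->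
  (forall k, dot (h - p) (g k) = 0) ->
  rnorm h ^+ 2 = rnorm p ^+ 2 + rnorm (h - p) ^+ 2.
Proof.
move=> pg hp; rewrite -(sqr_rnormD_orth norm_dot); first by rewrite addrC subrK.
by apply: (closed_span_orth norm_dot _ pg) => k; exact/dot_eq0C.
Qed.

Lemma coef_energy_eq g x y : (forall k, dot (x - y) (g k) = 0) ->
  coef_energy dot g x = coef_energy dot g y.
Proof.
move=> xy; apply: eq_eseriesr => k _.
by have := xy k; rewrite dotBl => /eqP; rewrite subr_eq0 => /eqP ->.
Qed.

(** The energy of [h] equals that of its projection on the closed span, which is no longer than [h];
    so a bound on the span holds everywhere. *)
Lemma frame_sequence_bessel g B : 0 <= B ->
  (forall x, closed_span g x -> (coef_energy dot g x <= (B * rnorm x ^+ 2)%:E)%E) ->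
  bessel_bound dot g B.
Proof.
move=> B0 gB; apply: bessel_boundP => h.
have [p pg hp] := span_projection norm_dot g h.
rewrite (coef_energy_eq hp) (le_trans (gB _ pg))// lee_fin ler_wpM2l//.
by rewrite (sqr_rnorm_projection pg hp) lerDl sqr_ge0.
Qed.

Lemma coef_energy_eq0 g x : coef_energy dot g x = 0%E <-> forall k, dot x (g k) = 0.
Proof.
split=> [x0 k|x0]; last first.
  by apply: eseries0 => k _ _; rewrite x0 rnorm0 expr0n.
have : (\sum_(0 <= j < k.+1) (rnorm (dot x (g j)) ^+ 2)%:E <= coef_energy dot g x)%E.
  by apply: nneseries_lim_ge => j _ _; rewrite lee_fin sqr_ge0.
rewrite x0 sumEFin lee_fin big_nat_recr//= => le0.
have s0 : 0 <= \sum_(0 <= j < k) rnorm (dot x (g j)) ^+ 2.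
  by rewrite sumr_ge0// => j _; rewrite sqr_ge0.
have q0 := sqr_ge0 (rnorm (dot x (g k))).
have /eqP : rnorm (dot x (g k)) ^+ 2 = 0 by lra.
by rewrite sqrf_eq0 rnorm_eq0 => /eqP.
Qed.

(** Pairing the sum with [phi k] recovers the coefficient of index [k]. *)
Lemma biorthogonal_expansion_unique psi phi x (c c' : nat -> R[i]) :
  (forall j k, dot (psi j) (phi k) = (j == k)%:R) ->
  series (fun k => c k *: psi k) n @[n --> \oo] --> x ->
  series (fun k => c' k *: psi k) n @[n --> \oo] --> x -> c = c'.
Proof.
move=> bi.
have coefE (a : nat -> R[i]) k : series (fun k => a k *: psi k) n @[n --> \oo] --> x ->
    dot x (phi k) = a k.
  move=> ax; apply: (dot_lim norm_dot ax); exists k.+1 => // n /= kn.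
  rewrite /series/= dot_suml (eq_bigr (fun j => if j == k then a j else 0)).
    by rewrite -big_mkcond/= big_nat1_eq kn.
  by move=> j _; rewrite dotZl bi; case: eqP; rewrite ?mulr1 ?mulr0.
by move=> cx c'x; apply/funext => k; rewrite -(coefE _ _ cx) (coefE _ _ c'x).
Qed.

(** [phi k] is the canonical dual vector, the preimage of [g k] under the frame operator. Its
    expansion and the trivial one both represent [g k], so uniqueness in the basis property forces
    [dot (phi k) (g j)] to be the Kronecker delta. *)
Lemma riesz_sequence_biorthogonal g : riesz_sequence dot g ->
  exists phi, (forall k, closed_span g (phi k)) /\
    forall j k, dot (g j) (phi k) = (j == k)%:R.
Proof.
move=> [[gE [A [B [A0 B0 gAB]]]] [_ gS]].
have gB : bessel_bound dot g B.
  by apply: frame_sequence_bessel (ltW B0) _ => x /gAB[].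
have cE : closure (closed_span g) `<=` closed_span g.
  exact: closed_closure.
have /choice[phi phiP] k : exists y, closed_span g y /\
    series (fun j => dot y (g j) *: g j) n @[n --> \oo] --> g k.
  have gA x : closed_span g x -> ((A * rnorm x ^+ 2)%:E <= coef_energy dot g x)%E.
    by move=> /gAB[].
  have [y yg yk] := frame_expansion norm_dot B0 gB (subspace_closed_span g) cE gE A0 gA (gE k).
  by exists y.
exists phi; split=> [k|j k]; first exact: (phiP k).1.
have [c [_ cu]] := gS _ (gE k).
have c1 := cu _ (phiP k).2.
have /cu c2 : series (fun j => (j == k)%:R *: g j) n @[n --> \oo] --> g k.
  apply: cvg_near_cst; exists k.+1 => // n /= kn.
  rewrite /series/= (eq_bigr (fun j => if j == k then g j else 0)).
    by rewrite -big_mkcond/= big_nat1_eq kn.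
  by move=> i _; case: eqP; rewrite ?scale1r ?scale0r.
have := congr1 (@^~ j) (etrans (esym c2) c1) => /= /esym e.
by rewrite dotC e; case: (j == k); rewrite ?conjc1 ?conjc0.
Qed.

Lemma nearby_bessel_complete g psi B :
  (forall h, exists p, [/\ closed_span g p, forall k, dot (h - p) (g k) = 0 &
     (coef_energy dot psi h = coef_energy dot g p + (rnorm (h - p) ^+ 2)%:E)%E]) ->
  0 < B -> bessel_bound dot g B -> bessel_sequence dot psi /\ complete_sequence psi.
Proof.
move=> psiE B0 gB; split.
  split=> //; exists (B + 1) => [|h _]; first by lra.
  have [p [pg hp ->]] := psiE h; have [s [_ -> sB]] := coef_energy_cvg p gB.
  rewrite -EFinD lee_fin (sqr_rnorm_projection pg hp).
  have := mulr_ge0 (ltW B0) (sqr_ge0 (rnorm (h - p))); have := sqr_ge0 (rnorm p).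
  lra.
apply/seteqP; split=> // h _; have [q qpsi hq] := span_projection norm_dot psi h.
suff -> : h = q by [].
apply/eqP; rewrite -subr_eq0; apply/eqP.
(* [h - q] has zero energy, so both summands of the identity vanish: [h - q] equals [p], which lies
   in the closed span of [g] and is orthogonal to every [g k], hence is zero. *)
have [p [pg hp]] := psiE (h - q); rewrite (coef_energy_eq0 _ _).2//.
have [s [_ sE _]] := coef_energy_cvg p gB.
have s0 : 0 <= s.
  by rewrite -lee_fin -sE; apply: nneseries_ge0 => k _ _; rewrite lee_fin sqr_ge0.
rewrite sE -EFinD => -[] /esym sum0.
have d0 := sqr_ge0 (rnorm (h - q - p)).
have s00 : s = 0 by lra.
have /eqP : rnorm (h - q - p) ^+ 2 = 0 by lra.
rewrite sqrf_eq0 rnorm_eq0 subr_eq0 => /eqP ->.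
apply: (dotxx_eq0 norm_dot); apply: (closed_span_orth norm_dot _ pg) => k.
by apply: dot_eq0C; apply: (coef_energy_eq0 g p).1; rewrite sE s00.
Qed.

Lemma nearby_frame g psi A B :
  (forall h, exists p, [/\ closed_span g p, forall k, dot (h - p) (g k) = 0 &
     (coef_energy dot psi h = coef_energy dot g p + (rnorm (h - p) ^+ 2)%:E)%E]) ->
  0 < A -> 0 < B -> bessel_bound dot g B ->
  (forall x, closed_span g x -> ((A * rnorm x ^+ 2)%:E <= coef_energy dot g x)%E) ->
  frame_for dot setT psi.
Proof.
move=> psiE A0 B0 gB gA; have [[_ [C C0 psiC]] _] := nearby_bessel_complete psiE B0 gB.
(* [A] controls the part of [h] in the closed span of [g], and 1 the part orthogonal to it. *)
split=> //; exists (Num.min A 1), C; split=> // [|h _]; first by rewrite lt_min A0 ltr01.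
split; last exact: psiC.
have [p [pg hp ->]] := psiE h; rewrite (sqr_rnorm_projection pg hp) mulrDr EFinD.
apply: leeD; last by rewrite lee_fin ler_piMl ?sqr_ge0// ge_min lexx orbT.
apply: le_trans (gA _ pg); rewrite lee_fin ler_wpM2r ?sqr_ge0//.
by rewrite ge_min lexx.
Qed.

(** Expansions exist by [frame_expansion] with [E] the whole space, and biorthogonality makes them
    unique. *)
Lemma biorthogonal_frame_riesz_basis psi phi : frame_for dot setT psi ->
  (forall j k, dot (psi j) (phi k) = (j == k)%:R) -> riesz_basis_for dot setT psi.
Proof.
move=> psif bi; split=> //; split=> // x _.
have [_ [A [B [A0 B0 psiAB]]]] := psif.
have psiB : bessel_bound dot psi B by apply: bessel_boundP => h; exact: (psiAB h I).2.
have psiA h : setT h -> ((A * rnorm h ^+ 2)%:E <= coef_energy dot psi h)%E.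
  by move=> _; exact: (psiAB h I).1.
have sT : subspace (@setT H) by [].
have [//|//|y _ yx] := frame_expansion norm_dot B0 psiB sT _ _ A0 psiA (x := x) I.
exists (fun k => dot y (psi k)); split=> // c cx.
exact: biorthogonal_expansion_unique bi yx cx.
Qed.

End NearbySequence.

Theorem theorem2p3 (R : realType) (H : completeNormedModType R[i])
  (dot : {dot H for Num.conj})
  (norm_dot : forall x : H, `|x| ^+ 2 = dot x x)
  (sepH : separable H) (infH : infinite_dimensional H)
  (g : nat -> H) :
  [/\ riesz_sequence dot g ->
        exists psi : nat -> H, riesz_basis_for dot setT psi /\
          rnorm (g k - psi k) @[k --> \oo] --> (0 : R),
      frame_sequence dot g ->
        exists psi : nat -> H, frame_for dot setT psi /\
          rnorm (g k - psi k) @[k --> \oo] --> (0 : R)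
    & bessel_sequence dot g ->
        exists psi : nat -> H,
          (bessel_sequence dot psi /\ complete_sequence psi) /\
          rnorm (g k - psi k) @[k --> \oo] --> (0 : R)]
  /\
  forall delta : R, 0 < delta ->
  [/\ riesz_sequence dot g ->
        exists psi : nat -> H, [/\ riesz_basis_for dot setT psi,
          rnorm (g k - psi k) @[k --> \oo] --> (0 : R)
        & forall k, rnorm (g k - psi k) <= delta],
      frame_sequence dot g ->
        exists psi : nat -> H, [/\ frame_for dot setT psi,
          rnorm (g k - psi k) @[k --> \oo] --> (0 : R)
        & forall k, rnorm (g k - psi k) <= delta]
    & bessel_sequence dot g ->
        exists psi : nat -> H,
        [/\ bessel_sequence dot psi /\ complete_sequence psi,
          rnorm (g k - psi k) @[k --> \oo] --> (0 : R)
        & forall k, rnorm (g k - psi k) <= delta]].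
Proof.
suff main : forall delta : R, 0 < delta ->
  [/\ riesz_sequence dot g ->
        exists psi : nat -> H, [/\ riesz_basis_for dot setT psi,
          rnorm (g k - psi k) @[k --> \oo] --> (0 : R)
        & forall k, rnorm (g k - psi k) <= delta],
      frame_sequence dot g ->
        exists psi : nat -> H, [/\ frame_for dot setT psi,
          rnorm (g k - psi k) @[k --> \oo] --> (0 : R)
        & forall k, rnorm (g k - psi k) <= delta]
    & bessel_sequence dot g ->
        exists psi : nat -> H,
        [/\ bessel_sequence dot psi /\ complete_sequence psi,
          rnorm (g k - psi k) @[k --> \oo] --> (0 : R)
        & forall k, rnorm (g k - psi k) <= delta]].
  split; last exact: main.
  (* Any positive [delta] gives the version without the uniform bound. *)
  have [m1 m2 m3] := main 1 ltr01.
  by split=> [/m1|/m2|/m3] [psi [? ? _]]; exists psi.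
move=> delta delta0.
have bessel_of_frame : frame_sequence dot g -> exists A B, [/\ 0 < A, 0 < B,
    bessel_bound dot g B &
    forall x, closed_span g x -> ((A * rnorm x ^+ 2)%:E <= coef_energy dot g x)%E].
  move=> [_ [A [B [A0 B0 gAB]]]]; exists A, B; split=> // [|x /gAB[]//].
  by apply: (frame_sequence_bessel norm_dot (ltW B0)) => x /gAB[].
split.
- move=> gR; have [A [B [A0 B0 gB gA]]] := bessel_of_frame gR.1.
  have [psi [psiE lim0 le_delta bi]] := nearby_sequence norm_dot sepH B0 gB delta0.
  exists psi; split=> //.
  have [phi [phig gphi]] := riesz_sequence_biorthogonal norm_dot gR.
  have [phi' bi'] := bi _ phig gphi.
  apply: (biorthogonal_frame_riesz_basis norm_dot _ bi').
  exact: (nearby_frame norm_dot psiE A0 B0 gB gA).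
- move=> /bessel_of_frame[A [B [A0 B0 gB gA]]].
  have [psi [psiE lim0 le_delta _]] := nearby_sequence norm_dot sepH B0 gB delta0.
  by exists psi; split=> //; exact: (nearby_frame norm_dot psiE A0 B0 gB gA).
- move=> [_ [B B0 gB0]].
  have gB : bessel_bound dot g B by apply: bessel_boundP => h; exact: gB0.
  have [psi [psiE lim0 le_delta _]] := nearby_sequence norm_dot sepH B0 gB delta0.
  by exists psi; split=> //; exact: (nearby_bessel_complete norm_dot psiE B0 gB).
Qed.
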